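(* Let $n\ge1$, let $\|\cdot\|$ be a norm on $\mathbb{R}^n$, and let $\varepsilon,\Delta>0$. Let $f$ be a probability density on $\mathbb{R}^n$, and let $f^\star$ denote its rearrangement. Then there exists a non-increasing function $\rho:[0,\infty)\to[0,\infty)$ such that $$f^\star(x)=\rho(\|x\|)\qquad\text{for all }x\in\mathbb{R}^n.$$ Moreover, $f^\star$ satisfies the DP constraint $$\{f^\star>\lambda\}_h\subseteq\{f^\star>\lambda e^{-h}\}\qquad\text{for all }\lambda>0,\ h>0,$$ where the $h$-enlargement is taken with respect to the metric $d_{\varepsilon,\Delta}(x,y)=\varepsilon\lceil\|x-y\|/\Delta\rceil$ on $\mathbb{R}^n$, if and only if $\log\rho$ is $1$-Lipschitz with respect to the one-dimensional metric $$d^{(1)}_{\varepsilon,\Delta}(r,s)=\varepsilon\Big\lceil\tfrac{|r-s|}{\Delta}\Big\rceil .$$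
   Context: Write $|A|$ for the Lebesgue measure of $A$ and $\mathbb{B}=\{x\in\mathbb{R}^n:\|x\|<1\}$. For measurable $A\subseteq\mathbb{R}^n$, its rearrangement is $A^\star=\{x\in\mathbb{R}^n:\|x\|<(|A|/|\mathbb{B}|)^{1/n}\}$. For measurable $f:\mathbb{R}^n\to[0,\infty)$, its (radially symmetric decreasing) rearrangement $f^\star:\mathbb{R}^n\to[0,\infty)$ is $f^\star(x)=\int_0^\infty \mathbf{1}_{\{f>\lambda\}^\star}(x)\,d\lambda$, where $\{f>\lambda\}=\{x:f(x)>\lambda\}$. For a metric $d$ on $\mathbb{R}^n$, a set $A\subseteq\mathbb{R}^n$ and $h\ge0$, the $h$-enlargement of $A$ is $A_h=\{x\in\mathbb{R}^n: d(x,y)<h\text{ for some }y\in A\}$. ''$\log\rho$ is $1$-Lipschitz with respect to $d^{(1)}_{\varepsilon,\Delta}$'' means $|\log\rho(r)-\log\rho(s)|\le d^{(1)}_{\varepsilon,\Delta}(r,s)$ for all $r,s\ge0$.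
   Formalization: For an essentially unbounded density f*(0) is infinite, so no finite-valued ρ exists; the formal statement lets f* and ρ take the value +∞, proving ρ finite on (0,∞), and on all of [0,∞) whenever f* is finite everywhere. *)

(* Defs.v *)
From HB Require Import structures.
From mathcomp Require Import all_boot all_order all_algebra.
From mathcomp Require Import all_classical all_reals all_analysis.

Set Implicit Arguments.
Unset Strict Implicit.
Unset Printing Implicit Defensive.
Import Order.TTheory GRing.Theory Num.Theory.
Import numFieldNormedType.Exports.

Local Open Scope classical_set_scope.
Local Open Scope ring_scope.

(** * Lebesgue measure on R^(n+1)

    The library has no n-dimensional Lebesgue measure. It is obtained here in
    the classical way: the Lebesgue outer measure is the infimum of the total
    volumes of countable covers by half-open boxes, and Caratheodory's theorem
    (in the library) restricts it to a measure on the sigma-algebra of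
    Lebesgue measurable sets. The dimension is a successor, so that empty boxes
    exist and have volume 0. *)

Section lebesgue_rV.
Context {R : realType} {n : nat}.
Implicit Types (A : set 'rV[R]_n.+1) (c : 'rV[R]_n.+1 * 'rV[R]_n.+1).

Definition box c : set 'rV[R]_n.+1 :=
  [set x | forall i, c.1 ord0 i < x ord0 i <= c.2 ord0 i].

Definition box_vol c : R := \prod_i Num.max 0 (c.2 ord0 i - c.1 ord0 i).

Definition box_cover A : set (nat -> 'rV[R]_n.+1 * 'rV[R]_n.+1) :=
  [set B | A `<=` \bigcup_k box (B k)].

Definition lebesgue_outer A : \bar R :=
  ereal_inf [set (\sum_(k <oo) (box_vol (B k))%:E)%E | B in box_cover A].

Lemma box_vol_ge0 c : (0 <= (box_vol c)%:E)%E.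
Proof. by rewrite lee_fin; apply: prodr_ge0 => i _; rewrite le_max lexx. Qed.

Lemma box_vol0 : box_vol (0, 0) = 0.
Proof. by rewrite /box_vol big_ord_recl /= mxE subrr maxxx mul0r. Qed.

Lemma lebesgue_outer_ge0 A : (0 <= lebesgue_outer A)%E.
Proof.
apply: le_ereal_inf_tmp => _ [B _ <-].
by apply: nneseries_ge0 => k _ _; exact: box_vol_ge0.
Qed.

Lemma lebesgue_outer0 : lebesgue_outer set0 = 0%E.
Proof.
apply/eqP; rewrite eq_le lebesgue_outer_ge0 andbT.
apply: ereal_inf_lbound; exists (fun=> (0, 0)); first by move=> x [].
by apply: eseries0 => k _ _; rewrite box_vol0.
Qed.

Lemma le_lebesgue_outer :
  {homo lebesgue_outer : A B / A `<=` B >-> (A <= B)%E}.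
Proof.
move=> A B AB; apply: ereal_inf_le_tmp => _ [C BC <-].
by exists C => //; exact: subset_trans AB BC.
Qed.

Lemma lebesgue_outer_sigma_subadditive : sigma_subadditive lebesgue_outer.
Proof.
move=> A; have [[i ioo]|] := pselect (exists i, lebesgue_outer (A i) = +oo%E).
  rewrite (eseries_pinfty _ _ ioo) ?leey// => k _.
  by rewrite -ltNye (lt_le_trans _ (lebesgue_outer_ge0 _)).
rewrite -forallNE => Aoo.
apply/lee_addgt0Pr => e e0.
rewrite (le_trans _ (epsilon_trick _ _ (ltW e0)))//; last first.
  by move=> k; exact: lebesgue_outer_ge0.
pose P k B := box_cover (A k) B /\ (\sum_(j <oo) (box_vol (B j))%:E <=
  lebesgue_outer (A k) + (e / (2 ^ k.+1)%:R)%:E)%E.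
have [G PG] : {G : nat -> _ & forall k, P k (G k)}.
  apply: (@choice _ _ P) => k; rewrite /P.
  have e2 : 0 < e / (2 ^ k.+1)%:R by rewrite divr_gt0// ltr0n expn_gt0.
  have fk : lebesgue_outer (A k) \is a fin_num.
    rewrite ge0_fin_numE ?lebesgue_outer_ge0// ltey; exact/eqP/Aoo.
  have [_ [B AB <-] Bk] := lb_ereal_inf_adherent e2 fk.
  by exists B; split => //; exact: ltW.
pose v := (fun ij : nat * nat => (box_vol (G ij.1 ij.2))%:E).
have v0 x : (0 <= v x)%E by exact: box_vol_ge0.
apply: (@le_trans _ _ (\esum_(i in setT) v i)%E).
  apply: ereal_inf_lbound => /=.
  have /card_esym/ppcard_eqP[f] := card_nat2.
  exists (fun k => G (f k).1 (f k).2).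
    move=> t [i _ /(PG i).1 [j _ Gt]].
    by exists (f^-1%FUN (i, j)) => //=; rewrite invK ?inE.
  by rewrite -(esum_pred_image v _ xpredT) ?[fun=> _]set_true// image_eq.
rewrite (_ : esum _ _ = \sum_(i <oo) \sum_(j <oo) v (i, j))%E; last first.
  pose J : nat -> set (nat * nat) := fun i => [set (i, j) | j in setT].
  rewrite (_ : setT = \bigcup_k J k); last first.
    by rewrite predeqE => -[a b]; split => // _; exists a => //; exists b.
  rewrite esum_bigcupT /=; last 2 first.
  - apply/trivIsetP => i j _ _ ij.
    rewrite predeqE => -[k m] /=; split => //= -[] [_] _ [<-{k} _].
    by move=> [m' _] [] /esym/eqP; rewrite (negbTE ij).
  - by [].
  rewrite -(image_id [set: nat]) -fun_true esum_pred_image//; last first.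
    by move=> k _; exact: esum_ge0.
  apply: eq_eseriesr => /= j _.
  rewrite -(esum_pred_image v (pair j) predT)//=; last first.
    by move=> ? ? _ _; exact: (@can_inj _ _ _ snd).
  by congr esum; rewrite predeqE => -[a b]; split; move=> [i _ <-]; exists i.
apply: lee_nneseries => [i _ _|i _]; last exact: (PG i).2.
by apply: nneseries_ge0 => j _ _; exact: box_vol_ge0.
Qed.

HB.instance Definition _ := isOuterMeasure.Build R _ lebesgue_outer
  lebesgue_outer0 lebesgue_outer_ge0 le_lebesgue_outer
  lebesgue_outer_sigma_subadditive.

End lebesgue_rV.

(** [rV_leb R n] is R^(n+1) with the sigma-algebra of Lebesgue measurable sets,
    and [lebesgue_rV] its (complete) Lebesgue measure. *)
Definition rV_leb (R : realType) (n : nat) : measurableType _ :=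
  caratheodory_type (@lebesgue_outer R n).

Definition lebesgue_rV (R : realType) (n : nat) : set (rV_leb R n) -> \bar R :=
  @lebesgue_outer R n.

HB.instance Definition _ (R : realType) (n : nat) :=
  isMeasure.Build _ (rV_leb R n) R (@lebesgue_rV R n)
    lebesgue_outer0 lebesgue_outer_ge0
    (@caratheodory_measure_sigma_additive R _ (@lebesgue_outer R n)).

Record is_norm (R : realType) (n : nat) (N : 'rV[R]_n.+1 -> R) : Prop := {
  is_norm_triangle : forall x y, N (x + y) <= N x + N y ;
  is_norm_homogeneous : forall a x, N (a *: x) = `|a| * N x ;
  is_norm_definite : forall x, N x = 0 -> x = 0 }.

Definition is_density (R : realType) (n : nat) (f : 'rV[R]_n.+1 -> R) : Prop :=
  [/\ measurable_fun [set: rV_leb R n] (f : rV_leb R n -> R),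
      forall x, 0 <= f x &
      (\int[@lebesgue_rV R n]_x (f x)%:E = 1)%E].

Section rearrangement.
Context {R : realType} {n : nat}.
Variable N : 'rV[R]_n.+1 -> R.
Implicit Types (A : set 'rV[R]_n.+1) (f : 'rV[R]_n.+1 -> R).

Definition unit_ball : set 'rV[R]_n.+1 := [set x | N x < 1].

Definition set_rearr A : set 'rV[R]_n.+1 :=
  [set x | ((N x)%:E <
    poweR (lebesgue_rV A / lebesgue_rV unit_ball) n.+1%:R^-1)%E].

(** The value is an extended real because the defining integral is +oo at the
    origin as soon as [f] is essentially unbounded. *)
Definition fun_rearr f (x : 'rV[R]_n.+1) : \bar R :=
  (\int[lebesgue_measure]_(l in `[0%R, +oo[)
     (\1_(set_rearr [set y | (l < f y)%R]) x)%:E)%E.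

End rearrangement.

Definition enlargement (R : realType) (T : Type) (d : T -> T -> R) (h : R)
    (A : set T) : set T :=
  [set x | exists2 y, A y & d x y < h].

(** The metric [eps * ceil(||x - y|| / Delta)] of a normed space [(V, N)]. *)
Definition dp_dist (R : realType) (V : zmodType) (N : V -> R) (eps Delta : R)
    (x y : V) : R :=
  eps * (Num.ceil (N (x - y) / Delta))%:~R.

Definition dp_constraint (R : realType) (n : nat) (N : 'rV[R]_n.+1 -> R)
    (eps Delta : R) (g : 'rV[R]_n.+1 -> \bar R) : Prop :=
  forall lambda h : R, 0 < lambda -> 0 < h ->
    enlargement (dp_dist N eps Delta) h [set x | (lambda%:E < g x)%E]
    `<=` [set x | ((lambda * expR (- h))%:E < g x)%E].

(** [lne] is the extended logarithm, with [lne 0 = -oo] and [lne +oo = +oo].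
    In [\bar R] one has [`|-oo - -oo| = `|+oo - +oo| = +oo], so the condition
    forces [log rho] to be real-valued, i.e. [0 < rho < +oo], on [0, +oo[. *)
Definition log_lipschitz1 (R : realType) (eps Delta : R) (rho : R -> \bar R) :
    Prop :=
  forall r s : R, 0 <= r -> 0 <= s ->
    (`| lne (rho r) - lne (rho s) | <=
       (dp_dist (fun t : R => `|t|%R) eps Delta r s)%:E)%E.

(* Main.v *)
(** By the layer-cake formula [f^*(x)] is the length of the interval of levels
    [l] such that the ball rearranging [{f > l}] has radius larger than
    [||x||]; this is a non-increasing function [rho] of [||x||], finite for
    [||x|| > 0] by Markov's inequality.

    Radii [r, s] are realised by two points of a common ray at distance
    [|r - s|], so the DP constraint says that [l < rho r] implies
    [l e^-h < rho s] for all [h > d(r, s)]. This spreads positivity from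
    [rho 0] to all radii and finiteness from positive radii to [0], and its
    logarithm is the Lipschitz bound. The converse follows from
    [| ||x|| - ||y|| | <= ||x - y||].

    The measure of the unit ball has to be finite and nonzero. It is finite
    because all norms are equivalent; if it were 0, the dilates of the ball
    would make the whole space null, which the existence of a density
    forbids, so no volume of a box needs to be computed. *)

Require Import Defs.
From HB Require Import structures.
From mathcomp Require Import all_boot all_order all_algebra.
From mathcomp Require Import all_classical all_reals all_analysis.
From mathcomp Require Import measurable_realfun.
From mathcomp Require Import lra.

Set Implicit Arguments.
Unset Strict Implicit.
Unset Printing Implicit Defensive.
Import Order.TTheory GRing.Theory Num.Theory.
Import numFieldNormedType.Exports.

Local Open Scope classical_set_scope.
Local Open Scope ring_scope.

(** * Norms on R^(n+1) and their equivalence with the sup norm *)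

Lemma ler_entry_mx_norm (R : realType) (m n : nat) (x : 'M[R]_(m, n)) i j :
  `|x i j| <= `|x|.
Proof.
rewrite [leRHS]/Num.norm /= mx_normrE.
by apply/bigmax_geP; right; exists (i, j).
Qed.

Section norm.
Context {R : realType} {n : nat} (N : 'rV[R]_n.+1 -> R).
Hypothesis hN : is_norm N.

Lemma is_norm0 : N 0 = 0.
Proof. by rewrite -(scale0r 0) (is_norm_homogeneous hN) normr0 mul0r. Qed.

Lemma is_normN x : N (- x) = N x.
Proof. by rewrite -scaleN1r (is_norm_homogeneous hN) normrN normr1 mul1r. Qed.

Lemma is_norm_ge0 x : 0 <= N x.
Proof.
have := is_norm_triangle hN x (- x).
by rewrite subrr is_norm0 is_normN -mulr2n pmulrn_lge0.
Qed.

Lemma is_norm_dist x y : `|N x - N y| <= N (x - y).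
Proof.
have := is_norm_triangle hN (x - y) y; have := is_norm_triangle hN (y - x) x.
rewrite !subrK -(opprB x y) is_normN => xy yx.
by rewrite ler_norml lerBlDr yx andbT lerNl opprB lerBlDr.
Qed.

(** Both points are multiples of the normalised all-ones vector; this turns statements about points
    into statements about radii. *)
Lemma is_norm_ray (r : R) : 0 <= r -> forall s, 0 <= s ->
  exists x y, [/\ N x = r, N y = s & N (x - y) = `|r - s|].
Proof.
move=> r0 s s0; pose u : 'rV[R]_n.+1 := const_mx 1.
have Nu : N u != 0.
  apply/eqP => /(is_norm_definite hN)/matrixP/(_ ord0 ord0)/eqP.
  by rewrite !mxE oner_eq0.
have Nray t : N ((t / N u) *: u) = `|t|.
  by rewrite (is_norm_homogeneous hN) normrM normfV (ger0_norm (is_norm_ge0 u)) divfK.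
exists ((r / N u) *: u), ((s / N u) *: u).
by rewrite -scalerBl -mulrBl !Nray (ger0_norm r0) (ger0_norm s0).
Qed.

Lemma is_norm_le_mx_norm : exists2 C, 0 <= C & forall x, N x <= C * `|x|.
Proof.
exists (\sum_(i < n.+1) N (delta_mx ord0 i)).
  by apply: sumr_ge0 => i _; exact: is_norm_ge0.
move=> x; rewrite {1}(row_sum_delta x) mulr_suml.
(* Generalised to an arbitrary list of indices so that induction applies. *)
have : forall s, N (\sum_(i <- s) x ord0 i *: delta_mx ord0 i)
    <= \sum_(i <- s) N (delta_mx ord0 i) * `|x|.
  elim=> [|i s ih]; first by rewrite !big_nil is_norm0.
  rewrite !big_cons (le_trans (is_norm_triangle hN _ _))// lerD//.
  rewrite (is_norm_homogeneous hN) mulrC ler_wpM2l ?is_norm_ge0//.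
  exact: ler_entry_mx_norm.
exact.
Qed.

Lemma is_norm_continuous : continuous N.
Proof.
have [C C0 NC] := is_norm_le_mx_norm.
(* [C] is only known to be nonnegative, hence the division by [C + 1] below. *)
have C1 : 0 < C + 1 by rewrite ltr_wpDl.
move=> x; apply/(@cvgrPdist_lt _ _ _ _ (nbhs_filter x)) => e e0; near=> y.
rewrite (le_lt_trans (is_norm_dist _ _))// (le_lt_trans (NC _))//.
rewrite (@le_lt_trans _ _ ((C + 1) * `|x - y|))// ?ler_wpM2r ?lerDl//.
rewrite mulrC -ltr_pdivlMr//; near: y.
by have := nbhsx_ballx x _ (divr_gt0 e0 C1); rewrite -ball_normE.
Unshelve. all: by end_near. Qed.

(** The continuous [N] attains its minimum on the compact sup-norm unit sphere; definiteness makes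
    it positive, and homogeneity extends the bound to all vectors. *)
Lemma is_norm_ge_mx_norm : exists2 c, 0 < c & forall x, c * `|x| <= N x.
Proof.
pose S : set 'rV[R]_n.+1 := [set x | `|x| = 1].
pose u : 'rV[R]_n.+1 := const_mx 1.
have Sne x : x != 0 -> S (`|x|^-1 *: x).
  by move=> x0; rewrite /S/= mx_normZ normfV normr_id mulVf// normr_eq0.
have S0 : S !=set0.
  exists (`|u|^-1 *: u); apply: Sne; apply/eqP => /matrixP/(_ ord0 ord0)/eqP.
  by rewrite !mxE oner_eq0.
have cS : compact S.
  apply: bounded_closed_compact.
    by exists 1; split => // M M1 x/= ->; exact: ltW.
  rewrite (_ : S = (fun x : 'rV[R]_n.+1 => `|x|) @^-1` [set 1])//.
  by apply: closed_comp => [x _|]; [exact: norm_continuous|exact: closed_eq].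
have [c + cmin] := EVT_min_rV S0 cS (continuous_subspaceT is_norm_continuous).
rewrite inE => Sc.
have Nc : 0 < N c.
  rewrite lt_def is_norm_ge0 andbT; apply/eqP => /(is_norm_definite hN) c0.
  by move: Sc; rewrite /S/= c0 normr0 => /eqP; rewrite eq_sym oner_eq0.
exists (N c) => // x; have [->|x0] := eqVneq x 0.
  by rewrite normr0 mulr0 is_norm_ge0.
have := cmin _ (mem_set (Sne x x0)); rewrite (is_norm_homogeneous hN).
by rewrite normfV normr_id mulrC ler_pdivlMr// normr_gt0.
Qed.

End norm.

(** * Outer measure of boxes and of dilates *)

Section outer_measure.
Context {R : realType} {n : nat}.
Local Notation V := 'rV[R]_n.+1.

Lemma lebesgue_outer_box (c : V * V) : (lebesgue_outer (box c) <= (box_vol c)%:E)%E.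
Proof.
apply: ereal_inf_lbound.
(* The box is followed by empty boxes, each coded by [(0, 0)]. *)
exists (fun k => if k == 0%N then c else (0, 0)); first by move=> x cx; exists 0%N.
rewrite nneseries_recl//; last by move=> *; exact: box_vol_ge0.
by rewrite eseries0 ?adde0// => -[]// k _ _; rewrite box_vol0.
Qed.

(** Dilating a cover of [A] covers the dilate of [A], and each of the [n.+1] edges of a box is
    multiplied by [k]. *)
Lemma lebesgue_outer_scale (k : R) (A : set V) : 0 < k ->
  (lebesgue_outer [set k *: x | x in A] <= (k ^+ n.+1)%:E * lebesgue_outer A)%E.
Proof.
move=> k0; have kn : 0 < k ^+ n.+1 by rewrite exprn_gt0.
rewrite -lee_pdivrMl//; apply: le_ereal_inf_tmp => _ [B AB <-].
rewrite lee_pdivrMl//; apply: ereal_inf_lbound.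
exists (fun j => (k *: (B j).1, k *: (B j).2)).
  move=> _ [x /AB[j _ Bx] <-]; exists j => // i.
  by rewrite /= !mxE ltr_pM2l// ler_pM2l.
rewrite -nneseriesZl; last by move=> j _; exact: box_vol_ge0.
apply: eq_eseriesr => j _; rewrite -EFinM; congr EFin.
rewrite /box_vol/= -[k ^+ _](_ : \prod_(i < n.+1) k = _); last first.
  by rewrite prodr_const card_ord.
rewrite -big_split/=; apply: eq_bigr => i _.
by rewrite !mxE -mulrBr maxr_pMr ?ltW// mulr0.
Qed.

End outer_measure.

(** * Measure of the unit ball *)

Section unit_ball.
Context {R : realType} {n : nat} (N : 'rV[R]_n.+1 -> R).
Hypothesis hN : is_norm N.

(** [N] is at least [c] times the sup norm, so the ball lies in the cube of half-side [c^-1]. *)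
Lemma lebesgue_outer_unit_ball_lty : (lebesgue_outer (unit_ball N) < +oo)%E.
Proof.
have [c c0 Nc] := is_norm_ge_mx_norm hN.
pose b : 'rV[R]_n.+1 := const_mx c^-1.
apply: (@le_lt_trans _ _ (box_vol (- b, b))%:E); last exact: ltry.
apply: le_trans (lebesgue_outer_box _); apply: le_lebesgue_outer => x Bx i.
rewrite /= !mxE.
have : `|x ord0 i| < c^-1.
  apply: (@le_lt_trans _ _ `|x|).
    exact: ler_entry_mx_norm.
  by rewrite -(mul1r c^-1) ltr_pdivlMr// mulrC (le_lt_trans (Nc x)).
by rewrite ltr_norml => /andP[-> /ltW].
Qed.

Lemma lebesgue_outer_unit_ball_eq0 :
  lebesgue_outer (unit_ball N) = 0%E -> lebesgue_outer [set: 'rV[R]_n.+1] = 0%E.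
Proof.
move=> B0; apply/eqP; rewrite eq_le lebesgue_outer_ge0 andbT.
pose D (k : nat) : set 'rV[R]_n.+1 := [set k.+1%:R *: x | x in unit_ball N].
apply: (@le_trans _ _ (lebesgue_outer (\bigcup_k D k))).
  apply: le_lebesgue_outer => x _.
  (* Since [N x < m.+1], the point lies in the dilate of the ball by [m.+1]. *)
  exists (Num.truncn (N x)) => //; set m := Num.truncn (N x).
  exists (m.+1%:R^-1 *: x); last by rewrite scalerA divff ?scale1r.
  rewrite /unit_ball/= (is_norm_homogeneous hN) ger0_norm ?invr_ge0//.
  by rewrite mulrC ltr_pdivrMr// mul1r truncnS_gt.
apply: le_trans (lebesgue_outer_sigma_subadditive D) _.
rewrite eseries0// => k _ _; apply/eqP; rewrite eq_le lebesgue_outer_ge0 andbT.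
by apply: le_trans (lebesgue_outer_scale _ _) _ => //; rewrite B0 mule0.
Qed.

End unit_ball.

(** * Superlevel sets of a density *)

Section density.
Context {R : realType} {n : nat} (f : 'rV[R]_n.+1 -> R).
Hypothesis hf : is_density f.
Local Notation mu := (@lebesgue_rV R n).

Lemma is_density_integral_abse : (\int[mu]_x `|(f x)%:E| = 1)%E.
Proof.
have [_ f0 <-] := hf.
by apply: eq_integral => x _; rewrite gee0_abs// lee_fin.
Qed.

Lemma is_density_measurable_EFin :
  measurable_fun [set: rV_leb R n] (EFin \o f).
Proof. by have [mf _ _] := hf; exact/measurable_EFinP. Qed.

Lemma lebesgue_rV_setT_neq0 : mu [set: 'rV[R]_n.+1] <> 0%E.
Proof.
move=> T0; have [_ _ f1] := hf.
have := null_set_integral (@measurableT _ (rV_leb R n))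
  is_density_measurable_EFin T0.
by rewrite f1 => /eqP; rewrite onee_eq0.
Qed.

(** Markov's inequality with total integral 1, applied to the larger set where [l] is at most the
    absolute value of [f]. *)
Lemma lebesgue_rV_superlevel_le (l : R) : 0 < l ->
  (mu [set y | (l < f y)%R] <= (l^-1)%:E)%E.
Proof.
move=> l0; have := le_integral_comp_abse mu measurableT (f := id)
  (@measurable_id _ _ _) (fun _ h => h) (fun _ _ _ _ h => h)
  is_density_measurable_EFin l0.
rewrite setTI is_density_integral_abse -lee_pdivlMl// mule1.
apply: le_trans; apply: le_lebesgue_outer => y /= ly.
by rewrite lee_fin (le_trans (ltW ly))// ler_norm.
Qed.

(** Otherwise {f > 0}, the union of the sets {f > 1/(k+1)}, would be null and the integral of [f]
    would be 0. *)
Lemma lebesgue_rV_superlevel_gt0 :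
  exists2 l : R, 0 < l & (0 < mu [set y | (l < f y)%R])%E.
Proof.
have [mf f0 _] := hf; apply: contrapT => H.
have Hl (l : R) : 0 < l -> mu [set y | (l < f y)%R] = 0%E.
  move=> l0; apply/eqP; rewrite eq_le lebesgue_outer_ge0 andbT leNgt.
  by apply/negP => ?; apply: H; exists l.
have mS (l : R) : measurable ([set y | (l < f y)%R] : set (rV_leb R n)).
  have := mf measurableT _ (measurable_itv `]l, +oo[).
  rewrite setTI; congr measurable; apply/seteqP; split => y /=;
    by rewrite in_itv/= andbT.
have : ae_eq mu setT (fun x => (f x)%:E) (cst 0%E).
  exists (\bigcup_k [set y | (k.+1%:R^-1 < f y)%R]); split.
  - exact: bigcup_measurable.
  - apply/eqP; rewrite eq_le lebesgue_outer_ge0 andbT.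
    apply: le_trans (lebesgue_outer_sigma_subadditive _) _.
    by rewrite eseries0// => k _ _; rewrite [LHS]Hl.
  - move=> y /= fy; have fy0 : 0 < f y.
      by rewrite lt_def f0 andbT; apply/eqP => fy0; apply: fy => _; rewrite fy0.
    exists (Num.truncn (f y)^-1) => //=.
    by rewrite invf_plt ?posrE ?ltr0n// truncnS_gt.
move/(ae_eq_integral_abs mu measurableT is_density_measurable_EFin).2.
by rewrite is_density_integral_abse => /eqP; rewrite onee_eq0.
Qed.

End density.

(** * The radial profile of the rearrangement *)

Section profile.
Context {R : realType} {n : nat} (N : 'rV[R]_n.+1 -> R) (f : 'rV[R]_n.+1 -> R).
Local Notation mu := (@lebesgue_rV R n).
Local Notation B := (unit_ball N).

(** Radius of the ball rearranging {f > l}; extended because {f > 0} may have infinite measure. *)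
Definition level_radius (l : R) : \bar R :=
  poweR (mu [set y | (l < f y)%R] / mu B) n.+1%:R^-1.

Definition levels_above (r : R) : set R :=
  [set l | 0 <= l /\ (r%:E < level_radius l)%E].

(** As the measure of a set of levels, it is estimated below by inclusions between such sets. *)
Definition radial_profile (r : R) : \bar R := lebesgue_measure (levels_above r).

Lemma le_level_radius (l m : R) : l <= m -> (level_radius m <= level_radius l)%E.
Proof.
move=> lm; have q0 (A : set 'rV[R]_n.+1) : (0 <= mu A / mu B)%E.
  by rewrite mule_ge0 ?inve_ge0// lebesgue_outer_ge0.
apply: gt0_ler_poweR; rewrite ?in_itv/= ?leey ?q0 ?invr_ge0//.
apply: lee_wpmul2r; first by rewrite inve_ge0 lebesgue_outer_ge0.
by apply: le_lebesgue_outer => y; exact: le_lt_trans.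
Qed.

(** The radius decreases with the level, so these levels form an interval. *)
Lemma measurable_levels_above r : measurable (levels_above r).
Proof.
apply: is_interval_measurable => l m [l0 _] [_ rm] t /andP[lt tm]; split.
  exact: le_trans lt.
exact: lt_le_trans (le_level_radius tm).
Qed.

Lemma fun_rearr_radial_profile x : fun_rearr N f x = radial_profile (N x).
Proof.
rewrite /fun_rearr /radial_profile.
rewrite (_ : levels_above (N x) = levels_above (N x) `&` `[0, +oo[); last first.
  by apply/seteqP; split=> l /= => [[l0 rl]|[]]//; rewrite in_itv/= l0.
rewrite -integral_indic//; last exact: measurable_levels_above.
apply: eq_integral => l; rewrite inE/= in_itv/= andbT => l0.
rewrite !indicE; congr (_%:R)%:E; congr (nat_of_bool _).
by apply/idP/idP; rewrite !inE; [split|case].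
Qed.

Lemma radial_profile_ge0 r : (0 <= radial_profile r)%E.
Proof. exact: measure_ge0. Qed.

Lemma le_radial_profile r s : r <= s -> (radial_profile s <= radial_profile r)%E.
Proof.
move=> rs; apply: le_measure; rewrite ?inE; try exact: measurable_levels_above.
by move=> l [l0 sl]; split=> //; apply: le_lt_trans sl; rewrite lee_fin.
Qed.

Hypotheses (hN : is_norm N) (hf : is_density f).

Lemma lebesgue_rV_unit_ball : exists2 b : R, 0 < b & mu B = b%:E.
Proof.
have Bfin : mu B \is a fin_num.
  by rewrite ge0_fin_numE ?lebesgue_outer_ge0// lebesgue_outer_unit_ball_lty.
exists (fine (mu B)); last by rewrite fineK.
rewrite fine_gt0// lebesgue_outer_unit_ball_lty// andbT lt_def lebesgue_outer_ge0.
rewrite andbT; apply/eqP => /(lebesgue_outer_unit_ball_eq0 hN).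
exact: lebesgue_rV_setT_neq0 hf.
Qed.

Lemma radial_profile_lty r : 0 < r -> (radial_profile r < +oo)%E.
Proof.
move=> r0; have [b b0 Bb] := lebesgue_rV_unit_ball.
(* By Markov, {f > M} has measure at most [M^-1], the measure of a ball of radius [r]; so all levels
   above [r] lie in [0, M]. *)
pose M := (b * r ^+ n.+1)^-1; have M0 : 0 < M by rewrite invr_gt0 mulr_gt0 ?exprn_gt0.
have rM : (level_radius M <= r%:E)%E.
  rewrite -[r%:E](_ : poweR (r ^+ n.+1)%:E n.+1%:R^-1 = _); last first.
    by rewrite poweR_EFin -powR_mulrn ?ltW// -powRrM divff// powRr1 ?ltW.
  apply: gt0_ler_poweR; rewrite ?invr_ge0// ?in_itv/= ?leey ?andbT.
  - by rewrite mule_ge0 ?inve_ge0// lebesgue_outer_ge0.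
  - by rewrite lee_fin exprn_ge0// ltW.
  rewrite Bb inver gt_eqF// lee_pdivrMr//.
  by apply: le_trans (lebesgue_rV_superlevel_le hf M0) _; rewrite invrK -EFinM mulrC.
apply: (@le_lt_trans _ _ (lebesgue_measure `[0, M])); last first.
  by rewrite lebesgue_measure_itv/= lte_fin M0 -EFinD ltry.
apply: le_measure; rewrite ?inE//; first exact: measurable_levels_above.
move=> l [l0 rl] /=; rewrite in_itv/= l0 leNgt; apply/negP => /ltW/le_level_radius.
by move=> /le_trans/(_ rM); rewrite leNgt rl.
Qed.

(** If {f > l} has positive measure, every level in [0, l] has positive radius. *)
Lemma radial_profile0_gt0 : (0 < radial_profile 0)%E.
Proof.
have [b b0 Bb] := lebesgue_rV_unit_ball.
have [l l0 fl] := lebesgue_rV_superlevel_gt0 hf.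
apply: (@lt_le_trans _ _ (lebesgue_measure `[0, l])).
  by rewrite lebesgue_measure_itv/= lte_fin l0 -EFinD subr0 lte_fin.
apply: le_measure; rewrite ?inE//; first exact: measurable_levels_above.
move=> m /=; rewrite in_itv/= => /andP[m0 ml]; split => //.
apply: lt_le_trans (le_level_radius ml); apply: poweR_gt0.
by rewrite mule_gt0// Bb inver gt_eqF// lte_fin invr_gt0.
Qed.

End profile.

(** * The DP constraint as a Lipschitz bound on radii *)

Section log_lipschitz.
Context {R : realType} {n : nat} (N : 'rV[R]_n.+1 -> R) (eps Delta : R).
Hypotheses (hN : is_norm N) (eps0 : 0 < eps) (Delta0 : 0 < Delta).
Local Notation dist1 := (dp_dist (fun t : R => `|t|%R) eps Delta).

Lemma dp_dist1_ge0 r s : 0 <= dist1 r s.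
Proof.
rewrite /dp_dist mulr_ge0 ?(ltW eps0)// ler0z.
by rewrite ceil_ge0 (@lt_le_trans _ _ 0) ?ltrN10// divr_ge0// ltW.
Qed.

Lemma le_dp_dist1 x y : dist1 (N x) (N y) <= dp_dist N eps Delta x y.
Proof.
rewrite /dp_dist ler_pM2l// ler_int; apply: ceil_le.
by rewrite ler_pM2r ?invr_gt0// is_norm_dist.
Qed.

Lemma dp_constraint_log_lipschitz1 (g : 'rV[R]_n.+1 -> \bar R)
    (rho : R -> \bar R) :
  (forall r, 0 < r -> (rho r < +oo)%E) -> (0 < rho 0%R)%E ->
  (forall x, g x = rho (N x)) ->
  dp_constraint N eps Delta g <-> log_lipschitz1 eps Delta rho.
Proof.
move=> rho_lty rho0 grho; split => [dp|lip].
- have dp_rho r s (l h : R) : 0 <= r -> 0 <= s -> 0 < l -> dist1 r s < h ->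
      (l%:E < rho r)%E -> ((l * expR (- h))%:E < rho s)%E.
    move=> r0 s0 l0 hrs lr; have [x [y [Nx Ny Nxy]]] := is_norm_ray hN s0 r0.
    have h0 : 0 < h by rewrite (le_lt_trans _ hrs)// dp_dist1_ge0.
    rewrite -Nx -grho; apply: dp => //; exists y; first by rewrite /= grho Ny.
    by rewrite /dp_dist Nxy distrC.
  have rho_gt0 s : 0 <= s -> (0 < rho s)%E.
    move=> s0; have [l l0 lrho] : exists2 l : R, 0 < l & (l%:E < rho 0%R)%E.
      move: rho0; case: (rho 0) => [p||]//.
        rewrite lte_fin => p0; exists (p / 2); first by rewrite divr_gt0.
        by rewrite lte_fin ltr_pdivrMr// ltr_pMr// ltr1n.
      by exists 1; rewrite ?ltry.
    apply: lt_trans (dp_rho _ _ _ (dist1 0 s + 1) (lexx 0) s0 l0 _ lrho); last first.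
      by rewrite ltrDl ltr01.
    by rewrite lte_fin mulr_gt0// expR_gt0.
  have rho_fin r : 0 <= r -> exists2 p : R, 0 < p & rho r = p%:E.
    move=> r0; have := rho_gt0 _ r0; case E: (rho r) => [p||]// => [p0|_].
      by exists p.
    (* Every level lies below +oo; the level [q * expR h] with [q = rho 1] would give
       [q < rho 1]. *)
    exfalso; have /rho_gt0 := @ler01 R; have := rho_lty _ (@ltr01 R).
    case E1: (rho 1) => [q||]// _; rewrite lte_fin => q0.
    pose h := dist1 r 1 + 1.
    have := dp_rho r 1 (q * expR h) h r0 ler01.
    rewrite E E1 -mulrA -expRD subrr expR0 mulr1 ltxx mulr_gt0 ?expR_gt0// ltry.
    by rewrite ltrDl ltr01 => /(_ isT isT isT).
  have lip_half r s : 0 <= r -> 0 <= s ->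
      (lne (rho r) - lne (rho s) <= (dist1 r s)%:E)%E.
    move=> r0 s0; have [p p0 rp] := rho_fin _ r0; have [q q0 sq] := rho_fin _ s0.
    rewrite rp sq !lne_EFin// -EFinD lee_fin leNgt; apply/negP => dpq.
    (* At level [q e^h < rho r] the constraint would give [q < rho s = q]. *)
    pose h := (dist1 r s + (ln p - ln q)) / 2.
    have [dh hpq] : dist1 r s < h /\ h < ln p - ln q by split; rewrite /h; lra.
    have := dp_rho r s (q * expR h) h r0 s0 _ dh.
    rewrite rp sq -mulrA -expRD subrr expR0 mulr1 !lte_fin ltxx.
    rewrite mulr_gt0 ?expR_gt0// => /(_ isT) qp.
    suff /qp : q * expR h < p by [].
    by rewrite -{1}(lnK q0) -(lnK p0) -expRD ltr_expR; lra.
  move=> r s r0 s0; have := lip_half _ _ r0 s0; have := lip_half _ _ s0 r0.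
  have [p p0 ->] := rho_fin _ r0; have [q q0 ->] := rho_fin _ s0.
  rewrite /dp_dist (distrC s r) !lne_EFin// -!EFinD !lee_fin ler_norml => qp ->.
  by rewrite lerNl opprB qp.
(* At two equal radii the bound is finite, whereas an infinite logarithm minus itself has absolute
   value +oo. *)
- have rho_fin r : 0 <= r -> exists2 p : R, 0 < p & rho r = p%:E.
    move=> r0; have := lip _ _ r0 r0; case: (rho r) => [p|//|//].
    by have [p0|p0] := ltP 0 p; [exists p|rewrite le0_lneNy].
  move=> l h l0 h0 x [y /= ly dxy].
  have [p p0 rp] := rho_fin _ (is_norm_ge0 hN x).
  have [q q0 sq] := rho_fin _ (is_norm_ge0 hN y).
  have := lip _ _ (is_norm_ge0 hN x) (is_norm_ge0 hN y).
  rewrite rp sq !lne_EFin// -EFinD lee_fin ler_norml => /andP[pq _].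
  move: ly; rewrite !grho rp sq !lte_fin => lq.
  (* With [d] the distance of the two norms: ln l < ln q <= ln p + d < ln p + h. *)
  have dh := le_lt_trans (le_dp_dist1 x y) dxy.
  have lnlq : ln l < ln q by rewrite ltr_ln ?posrE.
  by rewrite -{1}(lnK l0) -(lnK p0) -expRD ltr_expR; lra.
Qed.

End log_lipschitz.

Theorem proposition2 (R : realType) (n : nat) (N : 'rV[R]_n.+1 -> R)
    (eps Delta : R) (f : 'rV[R]_n.+1 -> R) :
  is_norm N -> 0 < eps -> 0 < Delta -> is_density f ->
  exists rho : R -> \bar R,
    [/\ forall r : R, 0 <= r -> (0 <= rho r)%E,
        forall r : R, 0 < r -> (rho r < +oo)%E,
        (forall x, (fun_rearr N f x < +oo)%E) ->
          forall r : R, 0 <= r -> (rho r < +oo)%E,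
        forall r s : R, 0 <= r -> r <= s -> (rho s <= rho r)%E &
        forall x, fun_rearr N f x = rho (N x)] /\
    (dp_constraint N eps Delta (fun_rearr N f) <->
     log_lipschitz1 eps Delta rho).
Proof.
move=> hN eps0 Delta0 hf; exists (radial_profile N f); split.
  split.
  - by move=> r _; exact: radial_profile_ge0.
  - exact: radial_profile_lty.
  - move=> f_lty r r0; have [x [_ [<- _ _]]] := is_norm_ray hN r0 r0.
    by rewrite -fun_rearr_radial_profile.
  - by move=> r s _; exact: le_radial_profile.
  - exact: fun_rearr_radial_profile.
apply: dp_constraint_log_lipschitz1 => //.
- exact: radial_profile_lty.
- exact: radial_profile0_gt0.
- exact: fun_rearr_radial_profile.
Qed.
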